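(* Let $(\mathcal B,\mathbb E,\mathfrak s)$ be an extriangulated category with enough projectives and enough injectives, let $n\ge2$ be an integer, and let $\mathcal M\subseteq\mathcal B$ be any $n$-cluster tilting subcategory. Then it induces a sequence of cotorsion pairs $$(\mathcal M_1,\mathcal Y_1)\ge(\mathcal M_2,\mathcal Y_2)\ge\cdots\ge(\mathcal M_{n-1},\mathcal Y_{n-1}).$$ Each cotorsion pair $(\mathcal M_\ell,\mathcal Y_\ell)$ $(1\le\ell\le n-1)$ has the core $\mathcal W_\ell=\Sigma^{\ell-1}\mathcal M$, the coheart $\mathcal C_\ell=\mathcal M$ and the kernel $\mathcal K_\ell=\mathcal M_{n-1}$.
   Context: Extriangulated category $(\mathcal B,\mathbb E,\mathfrak s)$: (ET1) $\mathcal B$ is an additive category and $\mathbb E\colon\mathcal B^{\mathrm{op}}\times\mathcal B\to \mathrm{Ab}$ is an additive bifunctor; for $\delta\in\mathbb E(C,A)$, $a\colon A\to A'$, $c\colon C'\to C$ write $a_*\delta=\mathbb E(C,a)(\delta)$ and $c^*\delta=\mathbb E(c,A)(\delta)$. Sequences $A\to B\to C$ and $A\to B'\to C$ are equivalent if there is an isomorphism $B\cong B'$ compatible with the identities of $A$ and $C$. $\mathfrak s$ assigns to each $\delta\in\mathbb E(C,A)$ an equivalence class $\mathfrak s(\delta)=[A\xrightarrow{x}B\xrightarrow{y}C]$; we say $A\xrightarrow{x}B\xrightarrow{y}C$ realizes $\delta$. (ET2) $\mathfrak s$ is an additive realization: if $A\xrightarrow{x}B\xrightarrow{y}C$ realizes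 $\delta$, $A'\xrightarrow{x'}B'\xrightarrow{y'}C'$ realizes $\delta'$ and $a\colon A\to A'$, $c\colon C\to C'$ satisfy $a_*\delta=c^*\delta'$, then there is $b\colon B\to B'$ with $bx=x'a$, $y'b=cy$; $0\in\mathbb E(C,A)$ is realized by the split sequence $A\to A\oplus C\to C$; and $\mathfrak s(\delta\oplus\delta')=\mathfrak s(\delta)\oplus\mathfrak s(\delta')$. (ET3) If $A\xrightarrow{x}B\xrightarrow{y}C$ realizes $\delta\in\mathbb E(C,A)$, $A'\xrightarrow{x'}B'\xrightarrow{y'}C'$ realizes $\delta'\in\mathbb E(C',A')$ and $a\colon A\to A'$, $b\colon B\to B'$ satisfy $bx=x'a$, then there is $c\colon C\to C'$ with $cy=y'b$ and $a_*\delta=c^*\delta'$; and (ET3)$^{\mathrm{op}}$, its dual. (ET4) If $\delta\in\mathbb E(D,A)$ and $\delta'\in\mathbb E(F,B)$ are realized by $A\xrightarrow{f}B\xrightarrow{f'}D$ and $B\xrightarrow{g}C\xrightarrow{g'}F$, there are an object $E$, morphisms $d\colon D\to E$, $e\colon E\to F$, $h'\colon C\to E$ with $h'g=df'$, $eh'=g'$, and $\delta''\in\mathbb E(E,A)$ realized by $A\xrightarrow{gf}C\xrightarrow{h'}E$, such that $D\xrightarrow{d}E\xrightarrow{e}F$ realizes $f'_*\delta'$, $d^*\delta''=\delta$ and $f_*\delta''=e^*\delta'$; and (ET4)$^{\mathrm{op}}$, its dual. A conflation $A\overset{x}{\rightarrowtail}B\overset{y}{\twoheadrightarrow}C$ is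 a sequence realizing some $\delta\in\mathbb E(C,A)$; then $x$ is an inflation and $y$ a deflation. An object $P$ is projective if $\mathbb E(P,\mathcal B)=0$ and $I$ is injective if $\mathbb E(\mathcal B,I)=0$; $\mathcal P$, $\mathcal I$ are the full subcategories of projectives and injectives. $\mathcal B$ has enough projectives (injectives) if every $B$ admits a deflation $P\to B$ with $P\in\mathcal P$ (an inflation $B\to I$ with $I\in\mathcal I$). For full subcategories $\mathcal X,\mathcal Y\subseteq\mathcal B$: $\mathrm{Cone}(\mathcal X,\mathcal Y)$ is the full subcategory of objects $B$ admitting a conflation $X\rightarrowtail Y\twoheadrightarrow B$, and $\mathcal X\ast\mathcal Y$ that of objects $B$ admitting a conflation $X\rightarrowtail B\twoheadrightarrow Y$, with $X\in\mathcal X$, $Y\in\mathcal Y$. A cotorsion pair $(\mathcal U,\mathcal V)$ on $\mathcal B$ is a pair of full additive subcategories closed under direct summands and isomorphisms with $\mathbb E(\mathcal U,\mathcal V)=0$ and such that every $B\in\mathcal B$ admits conflations $V_B\rightarrowtail U_B\twoheadrightarrow B$ and $B\rightarrowtail V^B\twoheadrightarrow U^B$ with $U_B,U^B\in\mathcal U$, $V_B,V^B\in\mathcal V$. Its core is $\mathcal U\cap\mathcal V$; its kernel is $\mathcal K=\mathrm{add}(\mathcal U\ast\mathcal V)$ ($\mathrm{add}$ = closure under direct summands in $\mathcal B$); its coheart is $\mathcal C={}^{\perp_1}\mathcal K=\mathcal U\cap{}^{\perp_1}\mathcal U$, where ${}^{\perp_1}\mathcal X=\{X\in\mathcal B\mid\mathbb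 E(X,\mathcal X)=0\}$. Write $(\mathcal U,\mathcal V)\le(\mathcal U',\mathcal V')$ if $\mathcal V\subseteq\mathcal V'$. Cosyzygies of subcategories: $\Sigma^0\mathcal X=\mathcal X$, $\Sigma^i\mathcal X=\mathrm{Cone}(\Sigma^{i-1}\mathcal X,\mathcal I)$ for $i>0$. For an object $X$ choose conflations $\Sigma^iX\rightarrowtail I^i\twoheadrightarrow\Sigma^{i+1}X$ with $I^i\in\mathcal I$ and $\Omega^{i+1}X\rightarrowtail P_i\twoheadrightarrow\Omega^iX$ with $P_i\in\mathcal P$ ($\Sigma^0X=\Omega^0X=X$). Higher extensions: $\mathbb E^{i+1}(X,Y)=\mathbb E(X,\Sigma^iY)\cong\mathbb E(\Omega^iX,Y)$ for $i\ge0$. A full subcategory $\mathcal M\subseteq\mathcal B$ is $n$-cluster tilting if (1) it is contravariantly finite and covariantly finite in $\mathcal B$; (2) $X\in\mathcal M$ iff $\mathbb E^i(X,\mathcal M)=0$ for all $1\le i\le n-1$; (3) $X\in\mathcal M$ iff $\mathbb E^i(\mathcal M,X)=0$ for all $1\le i\le n-1$. Define $\mathcal M_1=\mathcal M$, $\mathcal M_\ell=\mathrm{Cone}(\mathcal M_{\ell-1},\mathcal M)$ for $\ell>1$, and $\mathcal Y_\ell=\Sigma^{\ell-1}\mathcal M_{n-\ell}$ for $1\le\ell\le n-1$. *)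

(* Defs.v *)
From HB Require Import structures.
From mathcomp Require Import all_boot all_order all_algebra.
From mathcomp Require Import boolp classical_sets.

Set Implicit Arguments.
Unset Strict Implicit.
Unset Printing Implicit Defensive.

Import GRing.Theory.
Local Open Scope ring_scope.
Local Open Scope classical_set_scope.

(* Abelian groups (hom-sets and extension groups) are [zmodType]s; with the
   choice axiom of [boolp] every abelian group carries this structure. *)
Record preadditive_category := PreadditiveCategory {
  obj :> Type;
  hom : obj -> obj -> zmodType;
  idm : forall A, hom A A;
  comp : forall A B C, hom B C -> hom A B -> hom A C;
  compA : forall A B C D (h : hom C D) (g : hom B C) (f : hom A B),
    comp h (comp g f) = comp (comp h g) f;
  comp1m : forall A B (f : hom A B), comp (idm B) f = f;
  compm1 : forall A B (f : hom A B), comp f (idm A) = f;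
  compDl : forall A B C (g g' : hom B C) (f : hom A B),
    comp (g + g') f = comp g f + comp g' f;
  compDr : forall A B C (g : hom B C) (f f' : hom A B),
    comp g (f + f') = comp g f + comp g f' }.

Arguments idm {p} A.
Arguments comp {p A B C} g f.

Notation "g ∘ f" := (comp g f) (at level 40, left associativity) : ring_scope.

Definition is_iso (K : preadditive_category) (A B : K) (f : hom A B) : Prop :=
  exists g : hom B A, g ∘ f = idm A /\ f ∘ g = idm B.

Definition is_zero (K : preadditive_category) (Z : K) : Prop :=
  forall A : K, (forall f : hom Z A, f = 0) /\ (forall f : hom A Z, f = 0).

Record is_biproduct (K : preadditive_category) (A B S : K)
    (iA : hom A S) (iB : hom B S) (pA : hom S A) (pB : hom S B) : Prop :=
  IsBiproduct {
    biprod_pAiA : pA ∘ iA = idm A;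
    biprod_pBiB : pB ∘ iB = idm B;
    biprod_pBiA : pB ∘ iA = 0;
    biprod_pAiB : pA ∘ iB = 0;
    biprod_sum : iA ∘ pA + iB ∘ pB = idm S }.

Record additive_category := AdditiveCategory {
  add_precat :> preadditive_category;
  has_zero : exists Z : add_precat, is_zero Z;
  has_biproduct : forall A B : add_precat, exists (S : add_precat)
    (iA : hom A S) (iB : hom B S) (pA : hom S A) (pB : hom S B),
    is_biproduct iA iB pA pB }.

(* [ext C A] is E(C, A); [push a d] is a_* d and [pull c d] is c^* d. *)
Record additive_bifunctor (K : additive_category) := AdditiveBifunctor {
  ext : K -> K -> zmodType;
  push : forall C A A', hom A A' -> ext C A -> ext C A';
  pull : forall C C' A, hom C' C -> ext C A -> ext C' A;
  push1 : forall C A (d : ext C A), push (idm A) d = d;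
  pushM : forall C A A' A'' (a' : hom A' A'') (a : hom A A') (d : ext C A),
    push (a' ∘ a) d = push a' (push a d);
  pull1 : forall C A (d : ext C A), pull (idm C) d = d;
  pullM : forall C C' C'' A (c : hom C' C) (c' : hom C'' C') (d : ext C A),
    pull (c ∘ c') d = pull c' (pull c d);
  push_pull : forall C C' A A' (a : hom A A') (c : hom C' C) (d : ext C A),
    push a (pull c d) = pull c (push a d);
  pushD : forall C A A' (a : hom A A') (d d' : ext C A),
    push a (d + d') = push a d + push a d';
  pullD : forall C C' A (c : hom C' C) (d d' : ext C A),
    pull c (d + d') = pull c d + pull c d';
  pushDm : forall C A A' (a a' : hom A A') (d : ext C A),
    push (a + a') d = push a d + push a' d;
  pullDm : forall C C' A (c c' : hom C' C) (d : ext C A),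
    pull (c + c') d = pull c d + pull c' d }.

Arguments push {K} _ {C A A'} a d.
Arguments pull {K} _ {C C' A} c d.

Definition seq_equiv (K : preadditive_category) (A B B' C : K)
    (x : hom A B) (y : hom B C) (x' : hom A B') (y' : hom B' C) : Prop :=
  exists b : hom B B', [/\ is_iso b, b ∘ x = x' & y' ∘ b = y].

(* [realizes d x y] says that the sequence (x, y) belongs to s(d). The field
   [realizes_class] expresses that s(d) is exactly one equivalence class. *)
Record extriangulated_category := ExtriangulatedCategory {
  et_cat :> additive_category;
  et_E : additive_bifunctor et_cat;
  realizes : forall A B C : et_cat,
    ext et_E C A -> hom A B -> hom B C -> Prop;

  realizes_class : forall (A C : et_cat) (d : ext et_E C A),
    exists (B : et_cat) (x : hom A B) (y : hom B C),
      forall (B' : et_cat) (x' : hom A B') (y' : hom B' C),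
        realizes d x' y' <-> seq_equiv x y x' y';

  ET2_morphism : forall (A B C A' B' C' : et_cat)
      (d : ext et_E C A) (x : hom A B) (y : hom B C)
      (d' : ext et_E C' A') (x' : hom A' B') (y' : hom B' C')
      (a : hom A A') (c : hom C C'),
    realizes d x y -> realizes d' x' y' ->
    push et_E a d = pull et_E c d' ->
    exists b : hom B B', b ∘ x = x' ∘ a /\ y' ∘ b = c ∘ y;

  ET2_split : forall (A C S : et_cat)
      (iA : hom A S) (iC : hom C S) (pA : hom S A) (pC : hom S C),
    is_biproduct iA iC pA pC -> realizes (0 : ext et_E C A) iA pC;

  (* d (+) d' is the element of E(C (+) C', A (+) A') with components
     (d, 0, 0, d'), that is iA_* pC^* d + iA'_* pC'^* d'. *)
  ET2_sum : forall (A B C A' B' C' : et_cat)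
      (d : ext et_E C A) (x : hom A B) (y : hom B C)
      (d' : ext et_E C' A') (x' : hom A' B') (y' : hom B' C')
      (SA : et_cat) (iA : hom A SA) (iA' : hom A' SA)
      (pA : hom SA A) (pA' : hom SA A')
      (SB : et_cat) (iB : hom B SB) (iB' : hom B' SB)
      (pB : hom SB B) (pB' : hom SB B')
      (SC : et_cat) (iC : hom C SC) (iC' : hom C' SC)
      (pC : hom SC C) (pC' : hom SC C'),
    is_biproduct iA iA' pA pA' ->
    is_biproduct iB iB' pB pB' ->
    is_biproduct iC iC' pC pC' ->
    realizes d x y -> realizes d' x' y' ->
    realizes (push et_E iA (pull et_E pC d) + push et_E iA' (pull et_E pC' d'))
      (iB ∘ x ∘ pA + iB' ∘ x' ∘ pA') (iC ∘ y ∘ pB + iC' ∘ y' ∘ pB');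

  ET3 : forall (A B C A' B' C' : et_cat)
      (d : ext et_E C A) (x : hom A B) (y : hom B C)
      (d' : ext et_E C' A') (x' : hom A' B') (y' : hom B' C')
      (a : hom A A') (b : hom B B'),
    realizes d x y -> realizes d' x' y' -> b ∘ x = x' ∘ a ->
    exists c : hom C C', c ∘ y = y' ∘ b /\ push et_E a d = pull et_E c d';

  ET3op : forall (A B C A' B' C' : et_cat)
      (d : ext et_E C A) (x : hom A B) (y : hom B C)
      (d' : ext et_E C' A') (x' : hom A' B') (y' : hom B' C')
      (b : hom B B') (c : hom C C'),
    realizes d x y -> realizes d' x' y' -> c ∘ y = y' ∘ b ->
    exists a : hom A A', b ∘ x = x' ∘ a /\ push et_E a d = pull et_E c d';

  ET4 : forall (A B C D F : et_cat)
      (d1 : ext et_E D A) (f : hom A B) (f' : hom B D)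
      (d2 : ext et_E F B) (g : hom B C) (g' : hom C F),
    realizes d1 f f' -> realizes d2 g g' ->
    exists (E : et_cat) (d : hom D E) (e : hom E F) (h' : hom C E)
        (d3 : ext et_E E A),
      [/\ h' ∘ g = d ∘ f' /\ e ∘ h' = g',
          realizes d3 (g ∘ f) h',
          realizes (push et_E f' d2) d e,
          pull et_E d d3 = d1
        & push et_E f d3 = pull et_E e d2];

  ET4op : forall (A B C D F : et_cat)
      (d1 : ext et_E A D) (f' : hom D B) (f : hom B A)
      (d2 : ext et_E B F) (g' : hom F C) (g : hom C B),
    realizes d1 f' f -> realizes d2 g' g ->
    exists (E : et_cat) (d : hom E D) (e : hom F E) (h' : hom E C)
        (d3 : ext et_E A E),
      [/\ g ∘ h' = f' ∘ d /\ h' ∘ e = g',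
          realizes d3 h' (f ∘ g),
          realizes (pull et_E f' d2) e d,
          push et_E d d3 = d1
        & pull et_E f d3 = push et_E e d2] }.

Section Subcategories.
Variable B : extriangulated_category.

(* A full subcategory is given by its class of objects, a [set B]. *)
Implicit Types (X Y U V M : set B) (P : set B * set B).

Definition E (C A : B) : zmodType := ext (et_E B) C A.

Definition conflation (A S C : B) (x : hom A S) (y : hom S C) : Prop :=
  exists d : E C A, realizes d x y.

Definition inflation (A S : B) (x : hom A S) : Prop :=
  exists (C : B) (y : hom S C), conflation x y.

Definition deflation (S C : B) (y : hom S C) : Prop :=
  exists (A : B) (x : hom A S), conflation x y.

Definition projectives : set B :=
  [set Q | forall (A : B) (d : E Q A), d = 0].

Definition injectives : set B :=
  [set I | forall (C : B) (d : E C I), d = 0].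

Definition enough_projectives : Prop :=
  forall A : B, exists (Q : B) (y : hom Q A), projectives Q /\ deflation y.

Definition enough_injectives : Prop :=
  forall A : B, exists (I : B) (x : hom A I), injectives I /\ inflation x.

Definition Cone X Y : set B :=
  [set A | exists (A1 A2 : B) (x : hom A1 A2) (y : hom A2 A),
    [/\ X A1, Y A2 & conflation x y]].

Definition star X Y : set B :=
  [set A | exists (A1 A2 : B) (x : hom A1 A) (y : hom A A2),
    [/\ X A1, Y A2 & conflation x y]].

Definition summand (A S : B) : Prop :=
  exists (A' : B) (iA : hom A S) (iA' : hom A' S) (pA : hom S A)
    (pA' : hom S A'), is_biproduct iA iA' pA pA'.

Definition add X : set B := [set A | exists S : B, X S /\ summand A S].

Definition iso_closed X : Prop :=
  forall (A A' : B) (f : hom A A'), is_iso f -> X A -> X A'.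

Definition summand_closed X : Prop :=
  forall A S : B, summand A S -> X S -> X A.

Definition additive_subcategory X : Prop :=
  (exists Z : B, is_zero Z /\ X Z) /\
  (forall A A' : B, X A -> X A' -> exists (S : B) (iA : hom A S)
     (iA' : hom A' S) (pA : hom S A) (pA' : hom S A'),
     is_biproduct iA iA' pA pA' /\ X S).

Definition left_perp X : set B :=
  [set A | forall A' : B, X A' -> forall d : E A A', d = 0].

Record cotorsion_pair P : Prop := CotorsionPair {
  cp_additive1 : additive_subcategory P.1;
  cp_additive2 : additive_subcategory P.2;
  cp_summand1 : summand_closed P.1;
  cp_summand2 : summand_closed P.2;
  cp_iso1 : iso_closed P.1;
  cp_iso2 : iso_closed P.2;
  cp_orth : forall U0 V0 : B, P.1 U0 -> P.2 V0 -> forall d : E U0 V0, d = 0;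
  cp_resolution : forall A : B, exists (V0 U0 : B) (x : hom V0 U0)
    (y : hom U0 A), [/\ P.1 U0, P.2 V0 & conflation x y];
  cp_coresolution : forall A : B, exists (V0 U0 : B) (x : hom A V0)
    (y : hom V0 U0), [/\ P.1 U0, P.2 V0 & conflation x y] }.

Definition core P : set B := P.1 `&` P.2.

Definition kernel P : set B := add (star P.1 P.2).

Definition coheart P : set B := left_perp (kernel P).

Definition cotorsion_le P P' : Prop := P.2 `<=` P'.2.

Definition Sigma (i : nat) X : set B := iter i (Cone^~ injectives) X.

(* The objects Sigma^i A depend on the conflations chosen, so
   higher extensions are taken with respect to a choice; one exists as soon as
   there are enough injectives. *)
Record cosyzygy_choice := CosyzygyChoice {
  cosyz :> nat -> B -> B;
  cosyz0 : forall A : B, cosyz 0 A = A;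
  cosyzS : forall (i : nat) (A : B),
    exists (I : B) (x : hom (cosyz i A) I) (y : hom I (cosyz i.+1 A)),
      injectives I /\ conflation x y }.

Lemma cosyzygy_choice_exists : enough_injectives -> inhabited cosyzygy_choice.
Proof.
move=> hI.
have /choice[f fP] : forall A : B, exists C : B,
    exists (I : B) (x : hom A I) (y : hom I C), injectives I /\ conflation x y.
  move=> A; have [I [x [inI [C [y xy]]]]] := hI A.
  by exists C, I, x, y.
by constructor; exists (fun i => iter i f) => // i A; apply: fP.
Qed.

(* E^i(A, A') = E(A, Sigma^{i-1} A'); only used for i >= 1. *)
Definition higher_E (S : cosyzygy_choice) (i : nat) (A A' : B) : zmodType :=
  E A (S i.-1 A').

Definition contravariantly_finite M : Prop :=
  forall A : B, exists (M0 : B) (f : hom M0 A), M M0 /\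
    forall (M' : B) (g : hom M' A), M M' -> exists h : hom M' M0, g = f ∘ h.

Definition covariantly_finite M : Prop :=
  forall A : B, exists (M0 : B) (f : hom A M0), M M0 /\
    forall (M' : B) (g : hom A M'), M M' -> exists h : hom M0 M', g = h ∘ f.

Record cluster_tilting (S : cosyzygy_choice) (n : nat) M : Prop :=
  ClusterTilting {
    ct_contravariantly_finite : contravariantly_finite M;
    ct_covariantly_finite : covariantly_finite M;
    ct_left : forall A : B, M A <->
      forall i, (1 <= i <= n - 1)%N ->
      forall M0 : B, M M0 -> forall d : higher_E S i A M0, d = 0;
    ct_right : forall A : B, M A <->
      forall i, (1 <= i <= n - 1)%N ->
      forall M0 : B, M M0 -> forall d : higher_E S i M0 A, d = 0 }.

(* M_1 = M and M_l = Cone(M_{l-1}, M) for l > 1; index 0 is never used. *)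
Definition Msub M (l : nat) : set B := iter l.-1 (Cone^~ M) M.

Definition Ysub M (n l : nat) : set B := Sigma (l - 1) (Msub M (n - l)).

End Subcategories.

(* Main.v *)
From mathcomp Require Import all_boot all_order all_algebra.
From mathcomp Require Import boolp classical_sets.
From mathcomp Require Import zify.
Require Import Defs.

(** Everything is read off from the orders of vanishing of [E^i(M, -)]. Write
[G j] for the objects [A] with [E^i(M, A) = 0] for [1 <= i <= j]
([higher_perp M j]); it is encoded by [E(Omega^i M, A) = 0] for [i < j], a
condition that needs no choice of cosyzygies and passes to direct summands.
Cluster tilting says [M = G (n-1)].

Adding projectives to a right [M]-approximation makes it a deflation, and its
kernel lies in [M^perp]. So an object of [G j] has an [M]-approximation with
kernel in [G (j+1)], while the cone of a map from an object of [G (j+1)] to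
one of [M] lies in [G j]. Hence [M_l = G (n-l)] ([MsubE]).

The right half is [Y_l = Sigma^(l-1) (G l) = M_l^perp] ([Ysub_right_perp]).
Cosyzygies of objects of [M_l] are in [M_(l+1)], because injectives are in
[M]; thus an object of [M_l^perp], [l >= 2], is a quotient of an injective
whose kernel lies in [M_(l-1)^perp] and has order of vanishing one higher
([injective_deflation]). Iterating gives one inclusion, and the other is an
induction on [l] with long exact sequences. In particular [Y_l] decreases
with [l].

For completeness of the pair, an [M]-approximation of [A] and a resolution of
its kernel by the pair of index [l-1] are spliced, after replacing the
[Y]-term by its cosyzygy, into a resolution of [A] ([Msub_resolution]); the
coresolutions follow by Salce's argument ([Msub_coresolution]).

The core: an object of [M_l] and [Y_l] is an [(l-1)]-st cosyzygy of an object
whose order of vanishing has risen from [n-l] to [n-1], that is, of an object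
of [M]. The kernel: [M_l] and [Y_l] lie in [G 1 = M_(n-1)], which is closed
under extensions and summands; conversely a resolution [V -> U -> A] of an
object [A] of [G 1] gives [U -> I (+) A -> V'] with [V'] in [Y_l] when
[l < n-1]. The coheart is then the left orthogonal of [M_(n-1)]. It contains
[M] by the description of [M_(n-1)] as [M^perp], and is contained in [M]
because [M_(n-1)] contains the [i]-th cosyzygies of [M] for [i <= n-2]. *)

Set Implicit Arguments.
Unset Strict Implicit.
Unset Printing Implicit Defensive.

Import GRing.Theory.
Local Open Scope ring_scope.
Local Open Scope classical_set_scope.

(** * Biproducts *)

Section Preadditive.
Variable K : preadditive_category.
Implicit Types A S C : K.

Lemma comp0m A S C (f : hom A S) : (0 : hom S C) ∘ f = 0.
Proof. by apply: (addrI (0 ∘ f)); rewrite -compDl !addr0. Qed.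

Lemma compm0 A S C (g : hom S C) : g ∘ (0 : hom A S) = 0.
Proof. by apply: (addrI (g ∘ 0)); rewrite -compDr !addr0. Qed.

Lemma compNm A S C (g : hom S C) (f : hom A S) : (- g) ∘ f = - (g ∘ f).
Proof. by apply: (addrI (g ∘ f)); rewrite -compDl !subrr comp0m. Qed.

Lemma compmN A S C (g : hom S C) (f : hom A S) : g ∘ (- f) = - (g ∘ f).
Proof. by apply: (addrI (g ∘ f)); rewrite -compDr !subrr compm0. Qed.

Lemma biproduct_sym A C S (iA : hom A S) (iC : hom C S) pA pC :
  is_biproduct iA iC pA pC -> is_biproduct iC iA pC pA.
Proof. by case=> *; split=> //; rewrite addrC. Qed.

Lemma biproduct_zero_l (Z A : K) :
  is_zero Z -> is_biproduct (0 : hom Z A) (idm A) 0 (idm A).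
Proof.
move=> Z0; split; rewrite ?compm0 ?comp0m ?comp1m ?add0r //.
by rewrite ((Z0 Z).1 (idm Z)).
Qed.

Lemma biproduct_zero_r (Z A : K) :
  is_zero Z -> is_biproduct (idm A) (0 : hom Z A) (idm A) 0.
Proof. by move=> Z0; apply: biproduct_sym; apply: biproduct_zero_l. Qed.

(** An isomorphism is the case of a biproduct with zero complement, so that
closure under summands contains closure under isomorphisms. *)
Lemma biproduct_zero_iso (Z A S : K) (f : hom A S) (g : hom S A) :
  is_zero Z -> g ∘ f = idm A -> f ∘ g = idm S ->
  is_biproduct f (0 : hom Z S) g 0.
Proof.
move=> Z0 gf fg; split; rewrite ?compm0 ?comp0m ?addr0 //.
by rewrite ((Z0 Z).1 (idm Z)).
Qed.

Lemma biproduct_iso A C S T (iA : hom A S) (iC : hom C S) pA pC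
    (f : hom S T) (g : hom T S) :
  g ∘ f = idm S -> f ∘ g = idm T -> is_biproduct iA iC pA pC ->
  is_biproduct (f ∘ iA) (f ∘ iC) (pA ∘ g) (pC ∘ g).
Proof.
move=> gf fg [h1 h2 h3 h4 h5].
have e X Y (p : hom S X) (i : hom Y S) : p ∘ g ∘ (f ∘ i) = p ∘ i.
  by rewrite compA -(compA p) gf compm1.
split; rewrite ?e //.
by rewrite !compA -compDl -!(compA f) -compDr h5 compm1.
Qed.

(** Changing the inclusion of [C] along the graph of [f]: it presents any
morphism [f] as a component of a split deflation or inflation. *)
Lemma biproduct_shear A C S (iA : hom A S) (iC : hom C S) pA pC
    (f : hom C A) :
  is_biproduct iA iC pA pC ->
  is_biproduct iA (iC - iA ∘ f) (pA + f ∘ pC) pC.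
Proof.
move=> [h1 h2 h3 h4 h5]; split=> //.
- by rewrite compDl h1 -compA h3 compm0 addr0.
- by rewrite compDr compmN h2 compA h3 comp0m subr0.
- rewrite compDl !compDr !compmN h4 (compA pA) h1 comp1m -!(compA f) h2.
  by rewrite (compA pC) h3 comp0m compm0 compm1 subr0 sub0r addNr.
- by rewrite compDl compDr compNm !compA addrACA subrr addr0.
Qed.

End Preadditive.

(** * Exact sequences of a conflation *)

Section Extriangulated.
Variable B : extriangulated_category.
Implicit Types (A S C X Z : B) (U V M : set B).

Local Notation push := (push (et_E B)).
Local Notation pull := (pull (et_E B)).

Lemma push0 C A A' (a : hom A A') : push a (0 : E C A) = 0.
Proof. by apply: (addrI (push a 0)); rewrite -pushD !addr0. Qed.

Lemma pull0 C C' A (c : hom C' C) : pull c (0 : E C A) = 0.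
Proof. by apply: (addrI (pull c 0)); rewrite -pullD !addr0. Qed.

Lemma push0m C A A' (d : E C A) : push (0 : hom A A') d = 0.
Proof. by apply: (addrI (push 0 d)); rewrite -pushDm !addr0. Qed.

Lemma pull0m C C' A (d : E C A) : pull (0 : hom C' C) d = 0.
Proof. by apply: (addrI (pull 0 d)); rewrite -pullDm !addr0. Qed.

Lemma realizes_zero_l Z A :
  is_zero Z -> realizes (0 : E A Z) (0 : hom Z A) (idm A).
Proof. by move=> Z0; apply: ET2_split (biproduct_zero_l A Z0). Qed.

Lemma realizes_zero_r Z A :
  is_zero Z -> realizes (0 : E Z A) (idm A) (0 : hom A Z).
Proof. by move=> Z0; apply: ET2_split (biproduct_zero_r A Z0). Qed.

Lemma realizesP C A (d : E C A) :
  exists (S : B) (x : hom A S) (y : hom S C), realizes d x y.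
Proof.
have [S [x [y h]]] := realizes_class d; exists S, x, y; apply/h.
exists (idm S); split; rewrite ?comp1m ?compm1 //.
by exists (idm S); rewrite comp1m.
Qed.

Lemma realizes_unique C A (d : E C A) S S' (x : hom A S) (y : hom S C)
    (x' : hom A S') (y' : hom S' C) :
  realizes d x y -> realizes d x' y' ->
  exists (f : hom S S') (g : hom S' S),
    [/\ g ∘ f = idm S, f ∘ g = idm S', f ∘ x = x' & y ∘ g = y'].
Proof.
have [T [u [v h]]] := realizes_class d.
move=> /h [b [[c [cb bc]] bu yb]] /h [b' [[c' [cb' bc']] bu' yb']].
exists (b' ∘ c), (b ∘ c'); split.
- by rewrite compA -(compA b) cb' compm1.
- by rewrite compA -(compA b') cb compm1.
- by rewrite -bu -compA (compA c) cb comp1m.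
- by rewrite compA yb -yb' -compA bc' compm1.
Qed.

(** Compare with the trivial conflation [0 -> S -> S]. *)
Lemma pull_deflation A S C (d : E C A) (x : hom A S) (y : hom S C) :
  realizes d x y -> pull y d = 0.
Proof.
move=> xy; have [Z Z0] := has_zero B.
have [a [_ <-]] := ET3op (b := idm S) (c := y) (realizes_zero_l S Z0) xy erefl.
exact: push0.
Qed.

(** A sequence realizing a pulled back extension maps to the given
conflation; when the pulled back class is zero it is split, and the section
composed with that map is the lift. *)
Lemma lift_along_deflation A S C X (d : E C A) (x : hom A S) (y : hom S C)
    (g : hom X C) :
  realizes d x y -> pull g d = 0 -> exists h : hom X S, y ∘ h = g.
Proof.
move=> xy gd0; have [T [iA [iX [pA [pX bT]]]]] := has_biproduct A X.
have [|b [_ yb]] := ET2_morphism (a := idm A) (c := g) (ET2_split bT) xy.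
  by rewrite gd0 push0.
by exists (b ∘ iX); rewrite compA yb -compA (biprod_pBiB bT) compm1.
Qed.

Lemma extend_along_inflation A S C X (d : E C A) (x : hom A S) (y : hom S C)
    (g : hom A X) :
  realizes d x y -> push g d = 0 -> exists h : hom S X, h ∘ x = g.
Proof.
move=> xy gd0; have [T [iX [iC [pX [pC bT]]]]] := has_biproduct X C.
have [|b [bx _]] := ET2_morphism (a := g) (c := idm C) xy (ET2_split bT).
  by rewrite gd0 pull0.
by exists (pX ∘ b); rewrite -compA bx compA (biprod_pAiA bT) comp1m.
Qed.

(** If [x_* e = 0] then [x] extends to the middle term of [e], which gives a
morphism of conflations from [e] to [d] that is the identity on [A]. *)
Lemma ext_killed_by_inflation A S C X (d : E C A) (x : hom A S) (y : hom S C)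
    (e : E X A) :
  realizes d x y -> push x e = 0 -> exists g : hom X C, e = pull g d.
Proof.
move=> xy xe0; have [T [u [v uv]]] := realizesP e.
have [b bu] := extend_along_inflation uv xe0.
have [|c [_ h]] := ET3 (b := b) (a := idm A) uv xy; first by rewrite compm1.
by exists c; rewrite -h push1.
Qed.

Lemma ext_killed_by_deflation A S C X (d : E C A) (x : hom A S) (y : hom S C)
    (e : E C X) :
  realizes d x y -> pull y e = 0 -> exists g : hom A X, e = push g d.
Proof.
move=> xy ye0; have [T [u [v uv]]] := realizesP e.
have [b vb] := lift_along_deflation uv ye0.
have [|a [_ h]] := ET3op (b := b) (c := idm C) xy uv; first by rewrite comp1m.
by exists a; rewrite h pull1.
Qed.

(** Composing the inflation [x] with an inflation realizing [e] gives an
extension [d3] whose image under [x] agrees with [e] up to the deflation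
onto [X]; that deflation splits because [y_* e = 0]. *)
Lemma ext_middle A S C X (d : E C A) (x : hom A S) (y : hom S C) (e : E X S) :
  realizes d x y -> push y e = 0 -> exists e' : E X A, e = push x e'.
Proof.
move=> xy ye0; have [T [u [v uv]]] := realizesP e.
have [F [f [g [h [d3 [_ _ fg _ h3]]]]]] := ET4 xy uv.
have [|s gs] := lift_along_deflation (g := idm X) fg.
  by rewrite pull1.
by exists (pull s d3); rewrite push_pull h3 -pullM gs pull1.
Qed.

Lemma zero_ext_split A S C (x : hom A S) (y : hom S C) :
  realizes (0 : E C A) x y ->
  exists (i : hom C S) (p : hom S A), is_biproduct x i p y.
Proof.
move=> xy; have [T [iA [iC [pA [pC bT]]]]] := has_biproduct A C.
have [f [g [gf fg <- <-]]] := realizes_unique (ET2_split bT) xy.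
by exists (f ∘ iC), (pA ∘ g); apply: biproduct_iso bT.
Qed.

(** * Common middle terms of two conflations *)

(** Two conflations with the same third term have a weak pullback [T]: it
realizes the class with components [d1] and [d2] in [E(C, A1 (+) A2)], and
quotienting it by [A2] or by [A1] recovers the given conflations up to an
isomorphism of the middle terms. *)
Lemma conflation_pullback A1 S1 A2 S2 C (x1 : hom A1 S1) (y1 : hom S1 C)
    (x2 : hom A2 S2) (y2 : hom S2 C) :
  conflation x1 y1 -> conflation x2 y2 ->
  exists (T S1' S2' : B) (u1 : hom A1 T) (v2 : hom T S2') (u2 : hom A2 T)
      (v1 : hom T S1') (f1 : hom S1 S1') (f2 : hom S2 S2'),
    [/\ conflation u1 v2, conflation u2 v1, is_iso f1 & is_iso f2].
Proof.
move=> [d1 r1] [d2 r2].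
have [S [i1 [i2 [p1 [p2 bS]]]]] := has_biproduct A1 A2.
have [T [u [v uv]]] := realizesP (push i1 d1 + push i2 d2).
have [F1 [a1 [b1 [h1 [e1 [_ k1 q1 _ _]]]]]] :=
  ET4 (ET2_split (biproduct_sym bS)) uv.
have [F2 [a2 [b2 [h2 [e2 [_ k2 q2 _ _]]]]]] := ET4 (ET2_split bS) uv.
move: q1 q2; rewrite !pushD -!pushM (biprod_pAiA bS) (biprod_pBiB bS).
rewrite (biprod_pBiA bS) (biprod_pAiB bS) !push1 !push0m addr0 add0r => q1 q2.
have [f1 [g1 [gf1 fg1 _ _]]] := realizes_unique r1 q1.
have [f2 [g2 [gf2 fg2 _ _]]] := realizes_unique r2 q2.
exists T, F1, F2, (u ∘ i1), h2, (u ∘ i2), h1, f1, f2; split.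
- by exists e2.
- by exists e1.
- by exists g1.
- by exists g2.
Qed.

(** Dually, the weak pushout realizes the class with components [d1] and [d2]
in [E(C1 (+) C2, A)]. *)
Lemma conflation_pushout A S1 C1 S2 C2 (x1 : hom A S1) (y1 : hom S1 C1)
    (x2 : hom A S2) (y2 : hom S2 C2) :
  conflation x1 y1 -> conflation x2 y2 ->
  exists (T S1' S2' : B) (u1 : hom S1' T) (v2 : hom T C2) (u2 : hom S2' T)
      (v1 : hom T C1) (f1 : hom S1 S1') (f2 : hom S2 S2'),
    [/\ conflation u1 v2, conflation u2 v1, is_iso f1 & is_iso f2].
Proof.
move=> [d1 r1] [d2 r2].
have [S [i1 [i2 [p1 [p2 bS]]]]] := has_biproduct C1 C2.
have [T [u [v uv]]] := realizesP (pull p1 d1 + pull p2 d2).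
have [F1 [a1 [b1 [h1 [e1 [_ k1 q1 _ _]]]]]] := ET4op (ET2_split bS) uv.
have [F2 [a2 [b2 [h2 [e2 [_ k2 q2 _ _]]]]]] :=
  ET4op (ET2_split (biproduct_sym bS)) uv.
move: q1 q2; rewrite !pullD -!pullM (biprod_pAiA bS) (biprod_pBiB bS).
rewrite (biprod_pBiA bS) (biprod_pAiB bS) !pull1 !pull0m addr0 add0r => q1 q2.
have [f1 [g1 [gf1 fg1 _ _]]] := realizes_unique r1 q1.
have [f2 [g2 [gf2 fg2 _ _]]] := realizes_unique r2 q2.
exists T, F1, F2, h1, (p2 ∘ v), h2, (p1 ∘ v), f1, f2; split.
- by exists e1.
- by exists e2.
- by exists g1.
- by exists g2.
Qed.

(** * Vanishing of extensions *)

Definition ext_zero X A : Prop := forall d : E X A, d = 0.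

Definition right_perp U : set B := [set A | forall X, U X -> ext_zero X A].

Lemma summand_closed_iso U : summand_closed U -> iso_closed U.
Proof.
move=> hU A A' f [g [gf fg]]; apply: hU; have [Z Z0] := has_zero B.
by exists Z, g, 0, f, 0; apply: biproduct_zero_iso.
Qed.

Lemma right_perp_summand U : summand_closed (right_perp U).
Proof.
move=> A S [A' [i [i' [p [p' b]]]]] hS X UX d.
by rewrite -(push1 d) -(biprod_pAiA b) pushM (hS X UX (push i d)) push0.
Qed.

Lemma right_perp_iso U : iso_closed (right_perp U).
Proof. by apply: summand_closed_iso; apply: right_perp_summand. Qed.

Lemma right_perp_zero U Z : is_zero Z -> right_perp U Z.
Proof. by move=> Z0 X _ d; rewrite -(push1 d) ((Z0 Z).1 (idm Z)) push0m. Qed.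

Lemma right_perp_biproduct U A A' S (i : hom A S) (i' : hom A' S) p p' :
  is_biproduct i i' p p' -> right_perp U A -> right_perp U A' -> right_perp U S.
Proof.
move=> b hA hA' X UX d; rewrite -(push1 d) -(biprod_sum b) pushDm !pushM.
by rewrite (hA X UX (push p d)) (hA' X UX (push p' d)) !push0 addr0.
Qed.

Lemma right_perp_additive U : additive_subcategory (right_perp U).
Proof.
split.
  by have [Z Z0] := has_zero B; exists Z; split=> //; apply: right_perp_zero.
move=> A A' hA hA'; have [S [i [i' [p [p' b]]]]] := has_biproduct A A'.
by exists S, i, i', p, p'; split=> //; apply: right_perp_biproduct b hA hA'.
Qed.

Lemma right_perp_ext U A S C (x : hom A S) (y : hom S C) :
  conflation x y -> right_perp U A -> right_perp U C -> right_perp U S.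
Proof.
move=> [d xy] hA hC X UX e.
have [e' ->] := ext_middle xy (hC X UX (push y e)).
by rewrite (hA X UX e') push0.
Qed.

Lemma right_perp_injective U A : injectives A -> right_perp U A.
Proof. by by move=> iA X _; apply: (iA X). Qed.

(** A class in [E(X, C)] that dies on [Q] comes from a morphism [W -> C];
that morphism lifts to [S], so the class comes from [E(X, S)]. *)
Lemma ext_zero_cone W Q X A S C (u : hom W Q) (v : hom Q X)
    (x : hom A S) (y : hom S C) :
  conflation u v -> conflation x y ->
  ext_zero Q C -> ext_zero W A -> ext_zero X S -> ext_zero X C.
Proof.
move=> [d uv] [d' xy] hQC hWA hXS e.
have [g ->] := ext_killed_by_deflation uv (hQC (pull v e)).
have [h <-] := lift_along_deflation xy (hWA (pull g d')).
by rewrite pushM (hXS (push h d)) push0.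
Qed.

(** A class in [E(W, A)] that dies in [E(W, S)] comes from a morphism
[W -> C]; that morphism extends to [Q], so the class comes from [E(Q, A)]. *)
Lemma ext_zero_cocone W Q X A S C (u : hom W Q) (v : hom Q X)
    (x : hom A S) (y : hom S C) :
  conflation u v -> conflation x y ->
  ext_zero X C -> ext_zero W S -> ext_zero Q A -> ext_zero W A.
Proof.
move=> [d uv] [d' xy] hXC hWS hQA e.
have [g ->] := ext_killed_by_inflation xy (hWS (push x e)).
have [h <-] := extend_along_inflation uv (hXC (push g d)).
by rewrite pullM (hQA (pull h d')) pull0.
Qed.

(** * Syzygies and higher extensions *)

Definition syzygies U : set B :=
  [set W | exists (Q X : B) (u : hom W Q) (v : hom Q X),
    [/\ projectives Q, U X & conflation u v]].

Lemma right_perp_cone U A S C (x : hom A S) (y : hom S C) :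
  enough_projectives B -> conflation x y ->
  right_perp U S -> right_perp (syzygies U) A -> right_perp U C.
Proof.
move=> ep xy hS hA X UX; have [Q [v [pQ [W [u uv]]]]] := ep X.
apply: (ext_zero_cone uv xy _ _ (hS X UX)); first exact: (pQ C).
by apply: (hA W); exists Q, X, u, v.
Qed.

Lemma right_perp_cocone U A S C (x : hom A S) (y : hom S C) :
  conflation x y -> right_perp U C -> right_perp (syzygies U) S ->
  right_perp (syzygies U) A.
Proof.
move=> xy hC hS W sW; have [Q [X [u [v [pQ UX uv]]]]] := sW.
exact: (ext_zero_cocone uv xy (hC X UX) (hS W sW) (pQ A)).
Qed.

(** Vanishing of [E(U, Sigma^k A)] can be tested on [E(Omega^k U, A)]; the
latter form involves no choice of cosyzygies and is visibly inherited by
direct summands of [A]. *)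
Lemma right_perp_cosyz (T : cosyzygy_choice B) k U A :
  enough_projectives B ->
  right_perp U (T k A) <-> right_perp (iter k syzygies U) A.
Proof.
move=> ep; elim: k U => [|k IHk] U; first by rewrite cosyz0.
have [IH1 IH2] := IHk (syzygies U).
rewrite iterSr; have [I [x [y [iI xy]]]] := cosyzS T k A.
split=> h.
  by apply: IH1; apply: right_perp_cocone xy h _; apply: right_perp_injective.
by apply: right_perp_cone xy _ (IH2 h) => //; apply: right_perp_injective.
Qed.

(** With [E^(i+1)(U, A)] computed as [E(Omega^i U, A)], these are the objects
[A] with [E^i(U, A) = 0] for [1 <= i <= j]. *)
Definition higher_perp U (j : nat) : set B :=
  right_perp [set X | exists2 i, (i < j)%N & iter i syzygies U X].

Lemma higher_perpP U j A :
  higher_perp U j A <->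
  forall i, (i < j)%N -> right_perp (iter i syzygies U) A.
Proof.
split=> [h i ij X sX|h X [i ij sX]]; last exact: (h i ij X sX).
by apply: (h X); exists i.
Qed.

Lemma higher_perp_mono U i j :
  (i <= j)%N -> higher_perp U j `<=` higher_perp U i.
Proof.
move=> ij A /higher_perpP h; apply/higher_perpP => k ki.
by apply: h; apply: leq_trans ij.
Qed.

Lemma higher_perp1 U : higher_perp U 1 = right_perp U.
Proof.
apply/seteqP; split=> A; first by move/higher_perpP/(_ 0 isT).
by move=> h; apply/higher_perpP => -[].
Qed.

Lemma higher_perp_cone U j A S C (x : hom A S) (y : hom S C) :
  enough_projectives B -> conflation x y ->
  higher_perp U j S -> higher_perp U j.+1 A -> higher_perp U j C.
Proof.
move=> ep xy /higher_perpP hS /higher_perpP hA; apply/higher_perpP => i ij.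
by apply: right_perp_cone xy (hS i ij) _ => //; apply: (hA i.+1).
Qed.

Lemma higher_perp_cocone U j A S C (x : hom A S) (y : hom S C) :
  conflation x y -> right_perp U A ->
  higher_perp U j C -> higher_perp U j.+1 S -> higher_perp U j.+1 A.
Proof.
move=> xy hA /higher_perpP hC /higher_perpP hS.
apply/higher_perpP => -[//|i] ij.
by apply: right_perp_cocone xy (hC i ij) (hS i.+1 ij).
Qed.

Lemma SigmaS k U : Sigma k.+1 U = Cone (Sigma k U) (@injectives B).
Proof. by []. Qed.

Lemma Sigma_mono k U V : U `<=` V -> Sigma k U `<=` Sigma k V.
Proof.
move=> UV; elim: k => // k IHk A.
rewrite SigmaS => -[A1 [A2 [x [y [h1 h2 xy]]]]].
by exists A1, A2, x, y; split=> //; apply: IHk.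
Qed.

Lemma Sigma_higher_perp U k j :
  enough_projectives B ->
  Sigma k (higher_perp U (k + j)) `<=` higher_perp U j.
Proof.
move=> ep; elim: k j => [|k IHk] j A //.
rewrite SigmaS => -[A1 [A2 [x [y [h1 h2 xy]]]]].
apply: higher_perp_cone xy _ _ => //; first exact: right_perp_injective.
by apply: IHk; rewrite addnS.
Qed.

(** * Resolutions by a subcategory *)

Lemma MsubS U k : Msub U k.+2 = Cone (Msub U k.+1) U.
Proof. by []. Qed.

Lemma Msub_mono U k : (exists2 Z, is_zero Z & U Z) ->
  Msub U k.+1 `<=` Msub U k.+2.
Proof.
move=> [Z Z0 UZ]; elim: k => [|k IHk] A.
  move=> UA; rewrite MsubS; exists Z, A, 0, (idm A); split=> //.
  by exists 0; apply: realizes_zero_l.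
move=> [A1 [A2 [x [y [h1 h2 xy]]]]].
by exists A1, A2, x, y; split=> //; apply: IHk.
Qed.

(** The deflation is the composite of [p (+) 1 : Q (+) A0 -> A (+) A0], a sum
of deflations, with [(1, f) : A (+) A0 -> A], a split one. *)
Lemma deflation_sum Q A0 A S (p : hom Q A) (f : hom A0 A)
    (iQ : hom Q S) (i0 : hom A0 S) pQ p0 :
  is_biproduct iQ i0 pQ p0 -> deflation p -> deflation (p ∘ pQ + f ∘ p0).
Proof.
move=> bS [W [w [d wp]]]; have [Z Z0] := has_zero B.
have [T [iA [iT [pA [pT bT]]]]] := has_biproduct A A0.
have r := ET2_sum (biproduct_zero_r W Z0) bS bT wp (realizes_zero_l A0 Z0).
have bT' := biproduct_sym (biproduct_shear f bT).
have [F [_ [e [h [d3 [_ r3 _ _ _]]]]]] := ET4op (ET2_split bT') r.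
exists F, h, d3; move: r3; congr realizes.
rewrite !(compA, compDl, compDr, compm1) (biprod_pAiA bT) (biprod_pAiB bT).
by rewrite -!(compA f) (biprod_pBiA bT) (biprod_pBiB bT)
  !comp0m !comp1m compm0 add0r addr0.
Qed.

(** A deflation from [U] through which every morphism from [U] factors has a
kernel right orthogonal to [U]: the connecting map to [E(U, K)] vanishes and
[E(U, U) = 0]. *)
Lemma right_approximation U A :
  enough_projectives B -> contravariantly_finite U ->
  @projectives B `<=` U -> U `<=` right_perp U ->
  (forall A0 A1 S (i : hom A0 S) (i' : hom A1 S) p p',
     is_biproduct i i' p p' -> U A0 -> U A1 -> U S) ->
  exists (K A0 : B) (x : hom K A0) (y : hom A0 A),
    [/\ U A0, right_perp U K, conflation x y
      & forall X (g : hom X A), U X -> exists h, g = y ∘ h].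
Proof.
move=> ep cU PU UU addU.
have [A0 [f [UA0 fP]]] := cU A; have [Q [p [pQ dp]]] := ep A.
have [S [iQ [i0 [qQ [q0 bS]]]]] := has_biproduct Q A0.
have [K [x [d xy]]] := deflation_sum f bS dp.
have US : U S by apply: addU bS _ UA0; apply: PU.
have yP X (g : hom X A) : U X -> exists h, g = (p ∘ qQ + f ∘ q0) ∘ h.
  move=> UX; have [h ->] := fP X g UX; exists (i0 ∘ h).
  rewrite compDl -!compA !(compA q0) !(compA qQ) (biprod_pAiB bS).
  by rewrite (biprod_pBiB bS) comp0m comp1m compm0 add0r.
exists K, S, x, (p ∘ qQ + f ∘ q0); split=> //; last by exists d.
move=> X UX e.
have [g ->] := ext_killed_by_inflation xy (UU S US X UX (push x e)).
by have [h ->] := yP X g UX; rewrite pullM (pull_deflation xy) pull0.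
Qed.

(** * The cotorsion pairs of a cluster tilting subcategory *)

Section ClusterTilting.
Variables (T : cosyzygy_choice B) (n : nat) (M : set B).
Hypotheses (ep : enough_projectives B) (ei : enough_injectives B).
Hypotheses (n_ge2 : (2 <= n)%N) (M_ct : cluster_tilting T n M).

Local Notation G := (higher_perp M).

Lemma cluster_higher_perp : M = G (n - 1).
Proof.
apply/seteqP; split=> A.
  move/(ct_right M_ct) => h; apply/higher_perpP => i ij.
  apply/(right_perp_cosyz T i M A ep) => X MX.
  by apply: (h i.+1 _ X MX); rewrite ltnS in ij *.
move=> /higher_perpP h; apply/(ct_right M_ct) => -[//|i] ij X MX.
by apply: ((right_perp_cosyz T i M A ep).2 (h i _) X MX).
Qed.

Lemma cluster_sub_higher_perp j : (j <= n - 1)%N -> M `<=` G j.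
Proof. by rewrite {1}cluster_higher_perp; apply: higher_perp_mono. Qed.

Lemma cluster_rigid : M `<=` right_perp M.
Proof.
by rewrite -higher_perp1; apply: cluster_sub_higher_perp; rewrite subn_gt0.
Qed.

Lemma cluster_injective : @injectives B `<=` M.
Proof.
by move=> A iA; rewrite cluster_higher_perp; apply: right_perp_injective.
Qed.

Lemma cluster_projective : @projectives B `<=` M.
Proof. by move=> A pA; apply/(ct_left M_ct) => i _ X _; apply: pA. Qed.

Lemma cluster_zero : exists2 Z, is_zero Z & M Z.
Proof.
have [Z Z0] := has_zero B; exists Z => //.
by rewrite cluster_higher_perp; apply: right_perp_zero.
Qed.

Lemma cluster_biproduct A0 A1 S (i : hom A0 S) (i' : hom A1 S) p p' :
  is_biproduct i i' p p' -> M A0 -> M A1 -> M S.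
Proof. by rewrite cluster_higher_perp; apply: right_perp_biproduct. Qed.

Lemma cluster_approximation A :
  exists (K A0 : B) (x : hom K A0) (y : hom A0 A),
    [/\ M A0, right_perp M K, conflation x y
      & forall X (g : hom X A), M X -> exists h, g = y ∘ h].
Proof.
apply: right_approximation => //.
- exact: ct_contravariantly_finite M_ct.
- exact: cluster_projective.
- exact: cluster_rigid.
- exact: cluster_biproduct.
Qed.

Lemma higher_perp_approximation j A :
  (j < n - 1)%N -> G j A ->
  exists (K A0 : B) (x : hom K A0) (y : hom A0 A),
    [/\ M A0, G j.+1 K & conflation x y].
Proof.
move=> jn GA; have [K [A0 [x [y [MA0 hK xy _]]]]] := cluster_approximation A.
exists K, A0, x, y; split=> //; apply: (higher_perp_cocone xy hK GA).
exact: cluster_sub_higher_perp MA0.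
Qed.

(** One [M]-approximation raises the order of vanishing of [E^i(M, -)] by
one, and a cone lowers it by one. *)
Lemma MsubE k : (k.+1 <= n - 1)%N -> Msub M k.+1 = G (n - k.+1).
Proof.
elim: k => [|k IHk] kn; first exact: cluster_higher_perp.
have nk : (n - k.+1 = (n - k.+2).+1)%N by lia.
rewrite MsubS IHk 1?ltnW // nk; apply/seteqP; split=> A.
  move=> [A1 [A2 [x [y [h1 h2 xy]]]]]; apply: (higher_perp_cone ep xy _ h1).
  by apply: cluster_sub_higher_perp h2; lia.
move=> GA; have [|K [A0 [x [y [MA0 hK xy]]]]] := higher_perp_approximation _ GA.
  by lia.
by exists K, A0, x, y.
Qed.

Lemma cluster_sub_Msub k : M `<=` Msub M k.+1.
Proof.
by elim: k => [//|k IHk] A /IHk; apply: (Msub_mono cluster_zero).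
Qed.

Lemma Msub_cosyzygy k : Cone (Msub M k.+1) (@injectives B) `<=` Msub M k.+2.
Proof.
move=> A [A1 [A2 [x [y [h1 h2 xy]]]]]; rewrite MsubS.
by exists A1, A2, x, y; split=> //; apply: cluster_injective.
Qed.

(** If [E(M_l, A) = 0] with [l >= 2], the approximation [A0 -> A] can be
replaced by a deflation from an injective: for [A0 -> I -> A0'] the pushout
of [A0 -> A] is an extension of [A0'], which lies in [M_2], by [A]; it splits,
and [I -> A (+) A0' -> A] is a deflation. It inherits the factorization
property for maps from [M], hence, embedding an object of [M_(l-1)] in an
injective, for maps from [M_(l-1)]. *)
Lemma injective_deflation k A :
  right_perp (Msub M k.+2) A ->
  exists (A' I : B) (x : hom A' I) (y : hom I A),
    [/\ injectives I, right_perp (Msub M k.+1) A' & conflation x y].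
Proof.
move=> hA; have [K [A0 [x [y [MA0 _ [d xy] yP]]]]] := cluster_approximation A.
have [I [g [iI [A0' [g' [d' gg']]]]]] := ei A0.
have [F [f [e [h [d3 [[hg _] xh fe _ _]]]]]] := ET4 xy gg'.
have MA0' : Msub M k.+2 A0'.
  apply: Msub_cosyzygy; exists A0, I, g, g'; split=> //; last by exists d'.
  exact: cluster_sub_Msub.
have y0 : push y d' = 0 := hA A0' MA0' _.
rewrite y0 in fe; have [s [r bF]] := zero_ext_split fe.
have [A' [_ [u [q' [d4 [_ r4 _ _ _]]]]]] :=
  ET4op (ET2_split (biproduct_sym bF)) xh.
exists A', I, q', (r ∘ h); split=> //; last by exists d4.
move=> X MX c; have iI' : ext_zero X I by move=> ?; apply: iI.
have [t ->] := ext_killed_by_inflation r4 (iI' (push q' c)).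
(* The map [t] extends from [X] to an injective [J], as the cosyzygy [X'] is
   in the class orthogonal to [A]; and [J] is in [M]. *)
have [J [m [iJ [X' [m' [dX mm']]]]]] := ei X.
have MX' : Msub M k.+2 X'.
  by apply: Msub_cosyzygy; exists X, J, m, m'; split=> //; exists dX.
have [t' <-] := extend_along_inflation mm' (hA X' MX' (push t dX)).
have [t'' ->] := yP J t' (cluster_injective iJ).
have -> : y = r ∘ h ∘ g by rewrite -compA hg compA (biprod_pAiA bF) comp1m.
by rewrite -!compA compA pullM (pull_deflation r4) pull0.
Qed.

(** Each deflation from an injective [I] as above has a kernel [A'] with
[E^(i+1)(M, A') = E^i(M, A)], so every cosyzygy that is stripped off raises
the order of vanishing by one. *)
Lemma right_perp_Msub_sub k j :
  right_perp (Msub M k.+1) `&` G j `<=` Sigma k (G (k + j)).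
Proof.
elim: k j => [|k IHk] j A [hA GA] //.
have [A' [I [x [y [iI hA' xy]]]]] := injective_deflation hA.
rewrite SigmaS; exists A', I, x, y; split=> //.
rewrite addSnnS; apply: IHk; split=> //.
apply: (higher_perp_cocone xy _ GA); last exact: right_perp_injective.
by move=> X MX; apply: (hA' X); apply: cluster_sub_Msub.
Qed.

(** For [X1 -> X2 -> X] with [X1] in [M_(l-1)], [X2] in [M] and
[V' -> I -> V] the vanishing of [E(X2, V)] and [E(X1, V')] forces that of
[E(X, V)]; the former holds because [V] is in [G 1]. *)
Lemma Sigma_sub_right_perp k :
  Sigma k (G k.+1) `<=` right_perp (Msub M k.+1).
Proof.
elim: k => [|k IHk] V hV; first by rewrite -higher_perp1.
have hMV : right_perp M V.
  rewrite -higher_perp1; apply: (Sigma_higher_perp ep (k := k.+1)).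
  by rewrite addn1.
move: hV; rewrite SigmaS => -[V' [I [x [y [hV' iI xy]]]]].
have {}hV' : right_perp (Msub M k.+1) V'.
  by apply: IHk; apply: Sigma_mono hV'; apply: higher_perp_mono.
move=> X; rewrite MsubS => -[X1 [X2 [u [v [hX1 hX2 uv]]]]].
exact: (ext_zero_cone uv xy (hMV _ hX2) (hV' _ hX1) (iI X)).
Qed.

Lemma YsubE k : (k.+1 <= n - 1)%N -> Ysub M n k.+1 = Sigma k (G k.+1).
Proof.
move=> kn; rewrite /Ysub subn1 -[(n - k.+1)%N]prednK; last by lia.
by rewrite MsubE; [congr (Sigma _ (G _)); lia | lia].
Qed.

Lemma Ysub_right_perp k :
  (k.+1 <= n - 1)%N -> Ysub M n k.+1 = right_perp (Msub M k.+1).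
Proof.
move=> kn; rewrite YsubE //; apply/seteqP; split.
  exact: Sigma_sub_right_perp.
move=> A hA; rewrite -addn1; apply: right_perp_Msub_sub; split=> //.
by rewrite higher_perp1 => X MX; apply: (hA X); apply: cluster_sub_Msub.
Qed.

(** A conflation [A' -> S -> C] and an embedding of [A'] in an injective [I]
combine to [S -> I (+) C -> A''] up to isomorphism: the pushout of [S] along
[A' -> I] is an extension of [C] by an injective, so it splits. *)
Lemma injective_pushout A' S C I A'' (x : hom A' S) (y : hom S C)
    (u : hom A' I) (v : hom I A'') :
  injectives I -> conflation x y -> conflation u v ->
  exists (S' I' F : B) (a : hom S' F) (b : hom F A'') (f : hom S S')
      (i : hom I' F) (j : hom C F) (p : hom F I') (q : hom F C),
    [/\ is_iso f, injectives I', conflation a b & is_biproduct i j p q].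
Proof.
move=> iI xy uv.
have [F [S' [I' [a [b [i [q [f [g [ab [d iq] isf isg]]]]]]]]]] :=
  conflation_pushout xy uv.
have iI' : injectives I'.
  move=> X; apply: (right_perp_iso (U := setT) isg) => // Y _; exact: iI.
rewrite (iI' C d) in iq; have [j [p bF]] := zero_ext_split iq.
by exists S', I', F, a, b, f, i, j, p, q.
Qed.

Lemma Msub_iso k : (k.+1 <= n - 1)%N -> iso_closed (Msub M k.+1).
Proof. by move=> kn; rewrite MsubE //; apply: right_perp_iso. Qed.

(** Let [K -> A0 -> A] be an approximation, [V' -> U' -> K] given by induction
and [V' -> I -> V] a conflation with [I] injective. Then [U' -> I (+) K] is an
inflation with cone [V], and its composite with [I (+) K -> I (+) A0] is an
inflation whose cone [U] is in [M_l] and fits in [V -> U -> A]. *)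
Lemma Msub_resolution k j A :
  (j + k.+1 <= n - 1)%N -> G j A ->
  exists (V U : B) (x : hom V U) (y : hom U A),
    [/\ Msub M k.+1 U, Sigma k (G (j + k.+1)) V & conflation x y].
Proof.
elim: k j A => [|k IHk] j A jk GA.
  have [|K [A0 [x [y [MA0 hK xy]]]]] := higher_perp_approximation _ GA.
    by lia.
  by exists K, A0, x, y; split=> //; rewrite addn1.
have [|K [A0 [x [y [MA0 hK [dK xy]]]]]] := higher_perp_approximation _ GA.
  by lia.
have [|V' [U' [x' [y' [hU' hV' xy']]]]] := IHk j.+1 K _ hK; first by lia.
have [I [m [iI [V [m' mm']]]]] := ei V'.
have [S' [I' [F [a [b [f [i [c [p [q [isf iI' [dF ab] bF]]]]]]]]]]] :=
  injective_pushout iI xy' mm'.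
have [R [i1 [i2 [p1 [p2 bR]]]]] := has_biproduct I' A0.
have [Z Z0] := has_zero B.
have r := ET2_sum bF bR (biproduct_zero_l A Z0) (realizes_zero_r I' Z0) xy.
have [U [d [e [h [d3 [_ r3 r4 _ _]]]]]] := ET4 ab r.
exists V, U, d, e; split; last by move: r4; set dU := push b _ => r4; exists dU.
  rewrite MsubS; do 4![eexists]; split; last by exists d3; exact: r3.
    by apply: (Msub_iso _ isf) => //; lia.
  by apply: cluster_biproduct bR _ MA0; apply: cluster_injective.
by rewrite SigmaS; exists V', I, m, m'; split=> //; rewrite -addSnnS.
Qed.

(** Salce's argument: pull back [A -> I -> A'] along the resolution of the
cosyzygy [A']; the middle term is an extension of [I] by an object of the
right half. *)
Lemma Msub_coresolution k A :
  (k.+1 <= n - 1)%N ->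
  exists (V U : B) (x : hom A V) (y : hom V U),
    [/\ Msub M k.+1 U, right_perp (Msub M k.+1) V & conflation x y].
Proof.
move=> kn; have [I [x [iI [A' [y xy]]]]] := ei A.
have [//||V [U [v [u [hU hV vu]]]]] := @Msub_resolution k 0 A'.
  by apply/higher_perpP.
have [F [I' [U' [a [b [c [d [f [g [ab cd isf isg]]]]]]]]]] :=
  conflation_pullback xy vu.
exists F, U', a, b; split=> //; first exact: (Msub_iso kn isg hU).
apply: (right_perp_ext cd); first exact: Sigma_sub_right_perp.
by apply: (right_perp_iso isf); apply: right_perp_injective.
Qed.

Lemma Msub_cotorsion_pair k :
  (k.+1 <= n - 1)%N -> cotorsion_pair (Msub M k.+1, Ysub M n k.+1).
Proof.
move=> kn; rewrite Ysub_right_perp //; split=> /=.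
- by rewrite MsubE //; apply: right_perp_additive.
- exact: right_perp_additive.
- by rewrite MsubE //; apply: right_perp_summand.
- exact: right_perp_summand.
- exact: Msub_iso.
- exact: right_perp_iso.
- by move=> U V hU hV; apply: hV.
- move=> A; have [//||V [U [v [u [hU hV vu]]]]] := @Msub_resolution k 0 A.
    by apply/higher_perpP.
  by exists V, U, v, u; split=> //; apply: Sigma_sub_right_perp.
- by move=> A; apply: Msub_coresolution.
Qed.

Lemma Ysub_antitone k :
  (k.+2 <= n - 1)%N -> Ysub M n k.+2 `<=` Ysub M n k.+1.
Proof.
move=> kn; rewrite !Ysub_right_perp ?(ltnW kn) // => V hV X hX.
by apply: (hV X); apply: (Msub_mono cluster_zero hX).
Qed.

Lemma Msub_core k :
  (k.+1 <= n - 1)%N -> core (Msub M k.+1, Ysub M n k.+1) = Sigma k M.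
Proof.
move=> kn; rewrite /core /=; apply/seteqP; split=> A.
  rewrite Ysub_right_perp // {1}MsubE // => -[GA hA].
  have := right_perp_Msub_sub (conj hA GA).
  have -> : (k + (n - k.+1) = n - 1)%N by lia.
  by rewrite -cluster_higher_perp.
move=> hA; split; last first.
  rewrite YsubE //; apply: Sigma_mono hA.
  exact: cluster_sub_higher_perp.
elim: k A {kn} hA => [//|k IHk] A.
rewrite SigmaS => -[A1 [A2 [x [y [h1 h2 xy]]]]].
by apply: Msub_cosyzygy; exists A1, A2, x, y; split=> //; apply: IHk.
Qed.

Lemma Msub_last : Msub M (n - 1) = right_perp M.
Proof.
rewrite -higher_perp1 -[(n - 1)%N]prednK ?MsubE; try lia.
by congr (G _); lia.
Qed.

(** An object [A] of [M_(n-1)] has a resolution [V -> U -> A]; pushing it out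
along [V -> I] gives [U -> I (+) A -> V'], with [V'] a cosyzygy of [V]. This
[V'] is in [Y_l] if [l < n-1]; if [l = n-1] then [A] itself is in [M_l]. *)
Lemma Msub_kernel k :
  (k.+1 <= n - 1)%N ->
  kernel (Msub M k.+1, Ysub M n k.+1) = Msub M (n - 1).
Proof.
move=> kn; rewrite Msub_last; apply/seteqP; split=> A.
  move=> [S [[U [V [x [y [/= hU hV xy]]]]] /right_perp_summand]]; apply.
  apply: (right_perp_ext xy).
    by move: hU; rewrite -higher_perp1 MsubE //; apply: higher_perp_mono; lia.
  move: hV; rewrite Ysub_right_perp // => hV X MX.
  by apply: (hV X); apply: cluster_sub_Msub.
move=> hA; have [kn'|kn'] := leqP k.+2 (n - 1).
  have [||V [U [x [y [hU hV xy]]]]] := @Msub_resolution k 1 A.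
  - by lia.
  - by rewrite higher_perp1.
  have [I [u [iI [V' [v uv]]]]] := ei V.
  have [U' [I' [F [a [b [f [i [c [p [q [isf iI' ab bF]]]]]]]]]]] :=
    injective_pushout iI xy uv.
  exists F; split; last by exists I', c, i, q, p; apply: biproduct_sym.
  exists U', V', a, b; split=> //=; first exact: (Msub_iso kn isf hU).
  rewrite Ysub_right_perp // => X hX.
  have hV' : Sigma k.+1 (G k.+2) V' by exists V, I, u, v.
  by apply: (Sigma_sub_right_perp hV' (Msub_mono cluster_zero hX)).
have [Z Z0] := has_zero B.
have zA : realizes (0 : E Z A) (idm A) 0 := realizes_zero_r A Z0.
exists A; split; last first.
  by exists Z, (idm A), 0, (idm A), 0; apply: biproduct_zero_r.
exists A, Z, (idm A), 0; split=> /=; last by exists 0.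
  rewrite MsubE //; have -> : (n - k.+1 = 1)%N by lia.
  by rewrite higher_perp1.
by rewrite Ysub_right_perp //; apply: right_perp_zero.
Qed.

(** For [i <= n-2] this puts the [i]-th cosyzygies of [M] in [M_(n-1)]; the
vanishing of [E(A, -)] on all of them characterizes the objects of [M]. *)
Lemma cosyz_Msub i A : M A -> Msub M i.+1 (T i A).
Proof.
move=> MA; elim: i => [|i IHi]; first by rewrite cosyz0.
have [I [x [y [iI xy]]]] := cosyzS T i A.
by apply: Msub_cosyzygy; exists (T i A), I, x, y.
Qed.

Lemma Msub_coheart k :
  (k.+1 <= n - 1)%N -> coheart (Msub M k.+1, Ysub M n k.+1) = M.
Proof.
move=> kn; rewrite /coheart Msub_kernel // Msub_last.
apply/seteqP; split=> A; last by move=> MA X hX; apply: hX.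
move=> hA; apply/(ct_left M_ct) => -[//|i] ij X MX; apply: (hA (T i X)).
move: (cosyz_Msub i MX); rewrite MsubE // -higher_perp1.
by apply: higher_perp_mono; lia.
Qed.

End ClusterTilting.
End Extriangulated.

Theorem theorem5p14 (B : extriangulated_category) (S : cosyzygy_choice B)
    (n : nat) (M : set B)
    (enough_proj : enough_projectives B) (enough_inj : enough_injectives B)
    (n_ge2 : (2 <= n)%N) (M_ct : cluster_tilting S n M) :
  [/\ (forall l : nat, (1 <= l <= n - 1)%N ->
         cotorsion_pair (Msub M l, Ysub M n l)),
      (forall l : nat, (1 <= l)%N -> (l.+1 <= n - 1)%N ->
         cotorsion_le (Msub M l.+1, Ysub M n l.+1) (Msub M l, Ysub M n l))
    & (forall l : nat, (1 <= l <= n - 1)%N ->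
         [/\ core (Msub M l, Ysub M n l) = Sigma (l - 1) M,
             coheart (Msub M l, Ysub M n l) = M
           & kernel (Msub M l, Ysub M n l) = Msub M (n - 1)])].
Proof.
have kn k : (0 < k.+1 <= n - 1)%N -> (k.+1 <= n - 1)%N by case/andP.
split=> [[//|k]|[//|k] _|[//|k]] /= => [/kn k1|k2|/kn k1].
- exact: (Msub_cotorsion_pair enough_proj enough_inj n_ge2 M_ct k1).
- exact: (Ysub_antitone enough_proj enough_inj n_ge2 M_ct k2).
- rewrite subn1 /=; split.
  + exact: (Msub_core enough_proj enough_inj n_ge2 M_ct k1).
  + exact: (Msub_coheart enough_proj enough_inj n_ge2 M_ct k1).
  + exact: (Msub_kernel enough_proj enough_inj n_ge2 M_ct k1).
Qed.
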